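(* Let $A$ be a dcpo with a (possibly deficient) $\mu$Info-structure $(A,\mathcal I,\mathcal M(\mathcal I),\mu,\mathrm{Info},\mathrm{Neginfo})$, and let $\rho=\langle l,u\rangle$ be the induced relaxed metric. Then $u$ is a partial metric, $\rho:A\times A\to R^I$ is a Scott continuous relaxed metric, and the relaxed metric topology coincides with the Scott topology on $A$.
   Context: Directed sets are nonempty. A dcpo is a poset with least element in which every directed subset has a least upper bound. $U\subseteq A$ is Scott open if it is upward closed and meets every directed $S$ with $\sqcup S\in U$. Scott continuous means monotone and preserving directed suprema; $A\times A$ has the coordinatewise order. $\mathrm{Total}(A)$ is the set of maximal elements of $A$. A $\mu$Info-structure on a dcpo $A$ is a tuple $(A,\mathcal I,\mathcal M(\mathcal I),\mu,\mathrm{Info},\mathrm{Neginfo})$ where $\mathcal I$ is a set, $\mathcal M(\mathcal I)\subseteq\mathcal P(\mathcal I)$ is closed under $\cap,\cup,\setminus$ and contains $\emptyset$ and $\mathcal I$, $\mu:\mathcal M(\mathcal I)\to[0,1]$, and $\mathrm{Info},\mathrm{Neginfo}:A\to\mathcal M(\mathcal I)$, satisfying: 1. $\mu(\mathcal I)=1$, $\mu(\emptyset)=0$; $U\subseteq V\Rightarrow\mu(U)\le\mu(V)$; $\mu(U)+\mu(V)=\mu(U\cap V)+\mu(U\cup V)$. 2. $x\sqsubseteq y\Leftrightarrow\mathrm{Info}(x)\subseteq\mathrm{Info}(y)$; and $x\sqsubset y\Rightarrow\mathrm{Info}(x)\subsetneq\mathrm{Info}(y)$. 3. $\mathrm{Info}(x)\cap\mathrm{Neginfo}(x)=\emptyset$;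 $x\sqsubseteq y\Rightarrow\mathrm{Neginfo}(x)\subseteq\mathrm{Neginfo}(y)$. 4. (Strong respect for totality) $x\in\mathrm{Total}(A)\Rightarrow\mathrm{Info}(x)\cup\mathrm{Neginfo}(x)=\mathcal I$. 5. For every directed $B\subseteq A$ and $y\in A$, and for each choice of $P,Q\in\{\mathrm{Info},\mathrm{Neginfo}\}$: $\mu(P(\sqcup B)\cap Q(y))=\sup_{x\in B}\mu(P(x)\cap Q(y))$. 6. For every Scott open $U\subseteq A$ and $x\in U$ there is $\epsilon>0$ such that for all $y\in A$, $\mu(\mathrm{Info}(x))-\mu(\mathrm{Info}(x)\cap\mathrm{Info}(y))<\epsilon$ implies $y\in U$. It is called deficient when axiom 4 is not imposed. The induced relaxed metric is $\rho(x,y)=[l(x,y),u(x,y)]$ with $u(x,y)=1-\mu(\mathrm{Info}(x)\cap\mathrm{Info}(y))-\mu(\mathrm{Neginfo}(x)\cap\mathrm{Neginfo}(y))$ and $l(x,y)=\mu(\mathrm{Info}(x)\cap\mathrm{Neginfo}(y))+\mu(\mathrm{Info}(y)\cap\mathrm{Neginfo}(x))$. $R^I$ is the domain of intervals $[a,b]$, $0\le a\le b\le+\infty$, with $[a,b]\sqsubseteq[c,d]$ iff $a\le c$ and $d\le b$. A symmetric $\rho=[l,u]:A\times A\to R^I$ is a relaxed metric if $u(x,z)\le u(x,y)+u(y,z)$ for all $x,y,z$. The relaxed metric topology: $U\subseteq A$ is open iff for each $x\in U$ there is a real $\epsilon>u(x,x)$ with $\{y\mid u(x,y)<\epsilon\}\subseteq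 U$. A partial metric on a partially ordered set is a function $p\ge0$ with: $x=y$ iff $p(x,x)=p(x,y)=p(y,y)$; $p(x,x)\le p(x,y)$; $p(x,y)=p(y,x)$; $p(x,z)\le p(x,y)+p(y,z)-p(y,y)$; and moreover $p(x,x)=p(x,y)$ if $x\sqsubseteq y$, while $p(x,x)<p(x,y)$ if $x\not\sqsubseteq y$. *)

(* Defs.v *)
From HB Require Import structures.
From mathcomp Require Import all_boot all_order all_algebra.
From mathcomp Require Import all_classical all_reals all_analysis.

Set Implicit Arguments.
Unset Strict Implicit.
Unset Printing Implicit Defensive.

Import Order.TTheory GRing.Theory Num.Theory.
Local Open Scope classical_set_scope.
Local Open Scope ring_scope.

Definition directed d (T : porderType d) (S : set T) : Prop :=
  S !=set0 /\
  forall x y, S x -> S y -> exists z, [/\ S z, (x <= z)%O & (y <= z)%O].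

(* The least element is provided by [bPOrderType]. *)
Definition dcpo d (A : bPOrderType d) : Prop :=
  forall S : set A, directed S -> supremums S !=set0.

Definition scott_open d (T : porderType d) (U : set T) : Prop :=
  (forall x y, U x -> (x <= y)%O -> U y) /\
  (forall S s, directed S -> supremums S s -> U s -> (S `&` U) !=set0).

Definition scott_continuous d d' (T : porderType d) (T' : porderType d')
    (f : T -> T') : Prop :=
  {homo f : x y / (x <= y)%O} /\
  (forall S s, directed S -> supremums S s -> supremums (f @` S) (f s)).

Definition Total d (T : porderType d) : set T :=
  [set x | forall y, (x <= y)%O -> y = x].

(* The deficient structures do not impose [muInfo_total] below; [muInfo] adds
   it and coerces to [deficient_muInfo].
   [mu] is a function on all sets of which only the values on [Mea], the
   family M(I), are constrained. *)
Record deficient_muInfo (R : realType) d (A : bPOrderType d) := MuInfo {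
  Idx : Type ;
  Mea : set (set Idx) ;
  mu : set Idx -> R ;
  Info : A -> set Idx ;
  Neginfo : A -> set Idx ;

  MeaI : setI_closed Mea ;
  MeaU : setU_closed Mea ;
  MeaD : setD_closed Mea ;
  Mea0 : Mea set0 ;
  MeaT : Mea setT ;
  mu_itv : forall U, Mea U -> 0 <= mu U <= 1 ;
  Mea_Info : forall x, Mea (Info x) ;
  Mea_Neginfo : forall x, Mea (Neginfo x) ;

  mu_setT : mu setT = 1 ;
  mu_set0 : mu set0 = 0 ;
  mu_le : forall U V, Mea U -> Mea V -> U `<=` V -> mu U <= mu V ;
  mu_modular : forall U V, Mea U -> Mea V ->
    mu U + mu V = mu (U `&` V) + mu (U `|` V) ;

  Info_le : forall x y, (x <= y)%O <-> Info x `<=` Info y ;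
  Info_lt : forall x y, (x < y)%O -> Info x `<` Info y ;

  Info_Neginfo : forall x, Info x `&` Neginfo x = set0 ;
  Neginfo_le : forall x y, (x <= y)%O -> Neginfo x `<=` Neginfo y ;

  mu_directed : forall (B : set A) (b y : A) (P Q : A -> set Idx),
    directed B -> supremums B b ->
    [set Info; Neginfo] P -> [set Info; Neginfo] Q ->
    mu (P b `&` Q y) = sup [set mu (P x `&` Q y) | x in B] ;

  mu_scott : forall (U : set A) (x : A), scott_open U -> U x ->
    exists2 e : R, 0 < e &
      forall y, mu (Info x) - mu (Info x `&` Info y) < e -> U y
}.

Arguments Mea {R d A} _ _.
Arguments mu {R d A} _ _.
Arguments Info {R d A} _ _.
Arguments Neginfo {R d A} _ _.

Record muInfo (R : realType) d (A : bPOrderType d) := {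
  muInfo_deficient :> deficient_muInfo R A ;
  muInfo_total : forall x, Total x ->
    Info muInfo_deficient x `|` Neginfo muInfo_deficient x = setT
}.

Section InducedBounds.
Context (R : realType) d (A : bPOrderType d) (S : deficient_muInfo R A).

Definition upper (x y : A) : R :=
  1 - mu S (Info S x `&` Info S y) - mu S (Neginfo S x `&` Neginfo S y).

Definition lower (x y : A) : R :=
  mu S (Info S x `&` Neginfo S y) + mu S (Info S y `&` Neginfo S x).

End InducedBounds.

Section IntervalDomain.
Variable R : realType.

(* The domain of intervals [a, b] with 0 <= a <= b <= +oo, both ends in
   [\bar R], ordered by reverse inclusion. *)
Record interval_domain := IntervalDomain {
  ends : \bar R * \bar R ;
  _ : (0 <= ends.1)%E && (ends.1 <= ends.2)%E
}.

HB.instance Definition _ := [isSub for ends].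
HB.instance Definition _ := [Choice of interval_domain by <:].

Definition lend (a : interval_domain) : \bar R := (ends a).1.
Definition rend (a : interval_domain) : \bar R := (ends a).2.

Definition refines (a b : interval_domain) : bool :=
  (lend a <= lend b)%E && (rend b <= rend a)%E.

Lemma refines_refl : reflexive refines.
Proof. by move=> a; rewrite /refines !lexx. Qed.

Lemma refines_anti : antisymmetric refines.
Proof.
move=> a b /andP[/andP[ab1 ba2] /andP[ba1 ab2]]; apply/val_inj => /=.
have e1 : lend a = lend b by apply/le_anti; rewrite ab1 ba1.
have e2 : rend a = rend b by apply/le_anti; rewrite ab2 ba2.
by rewrite [LHS]surjective_pairing [RHS]surjective_pairing; congr pair.
Qed.

Lemma refines_trans : transitive refines.
Proof.
move=> b a c /andP[ab1 ba2] /andP[bc1 cb2].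
by rewrite /refines (le_trans ab1 bc1) (le_trans cb2 ba2).
Qed.

Fact interval_domain_display : Order.disp_t. Proof. exact. Qed.

HB.instance Definition _ :=
  Order.Le_isPOrder.Build interval_domain_display interval_domain
    refines_refl refines_anti refines_trans.

End IntervalDomain.

Definition relaxed_metric (R : realType) (T : Type)
    (rho : T * T -> interval_domain R) : Prop :=
  (forall x y, rho (x, y) = rho (y, x)) /\
  (forall x y z,
    (rend (rho (x, z)) <= rend (rho (x, y)) + rend (rho (y, z)))%E).

Definition relaxed_open (R : realType) (T : Type)
    (rho : T * T -> interval_domain R) (U : set T) : Prop :=
  forall x, U x -> exists2 e : R, (rend (rho (x, x)) < e%:E)%E &
    [set y | (rend (rho (x, y)) < e%:E)%E] `<=` U.

Record partial_metric (R : realType) d (T : porderType d) (p : T -> T -> R) :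
    Prop := PartialMetric {
  pm_ge0 : forall x y, 0 <= p x y ;
  pm_sep : forall x y, x = y <-> (p x x = p x y /\ p x y = p y y) ;
  pm_self : forall x y, p x x <= p x y ;
  pm_sym : forall x y, p x y = p y x ;
  pm_triangle : forall x y z, p x z <= p x y + p y z - p y y ;
  pm_le : forall x y, (x <= y)%O -> p x x = p x y ;
  pm_nle : forall x y, ~ (x <= y)%O -> p x x < p x y
}.

(* Main.v *)
Require Import Defs.
From mathcomp Require Import all_boot all_order all_algebra.
From mathcomp Require Import all_classical all_reals all_analysis.
From mathcomp Require Import lra.

(** The inequalities between [l] and [u] only use monotonicity and modularity
of [mu]. The strict inequality [u x x < u x y] when [x] is not below [y] comes
from the last axiom of the structure, applied to the Scott open set of the
elements not below [y]. Scott continuity, and the fact that relaxed open sets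
are inaccessible by directed suprema, come from approximating
[mu (P b `&` Q y)] by [mu (P x `&` Q y)] with [x] in a directed set of supremum
[b], one coordinate after the other. *)

Set Implicit Arguments.
Unset Strict Implicit.
Unset Printing Implicit Defensive.

Import Order.TTheory GRing.Theory Num.Theory.
Local Open Scope classical_set_scope.
Local Open Scope ring_scope.

(** If no element of [D] escaped [y], then [y] would bound [D], hence also its supremum [s]. *)
Lemma scott_open_not_le d (T : porderType d) (y : T) :
  scott_open [set z | ~ (z <= y)%O].
Proof.
split=> [a b /= nay ab /(le_trans ab)//|D s _ [_ lubs] /= nsy].
apply: contrapT => noD; apply: nsy; apply: lubs => z Dz.
by apply: contrapT => nzy; apply: noD; exists z.
Qed.

(** * Projections of directed sets and suprema in a product *)

Section ProductSupremums.
Context d1 d2 (T1 : porderType d1) (T2 : porderType d2).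
Variables (D : set (T1 *p T2)%type) (s : (T1 *p T2)%type).

Lemma directed_fst : directed D -> directed [set p.1 | p in D].
Proof.
move=> [[p Dp] dD]; split; first by exists p.1, p.
move=> _ _ [a Da <-] [b Db <-]; have [c [Dc ac bc]] := dD _ _ Da Db.
move: ac bc; rewrite !leEprod => /andP[ac _] /andP[bc _].
by exists c.1; split=> //; exists c.
Qed.

Lemma directed_snd : directed D -> directed [set p.2 | p in D].
Proof.
move=> [[p Dp] dD]; split; first by exists p.2, p.
move=> _ _ [a Da <-] [b Db <-]; have [c [Dc ac bc]] := dD _ _ Da Db.
move: ac bc; rewrite !leEprod => /andP[_ ac] /andP[_ bc].
by exists c.2; split=> //; exists c.
Qed.

(** A bound [b] of the first projections yields the bound [(b, s.2)] of [D], which then lies above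
    [s]. *)
Lemma supremums_fst : supremums D s -> supremums [set p.1 | p in D] s.1.
Proof.
move=> [ubs lubs]; split=> [_ [p /ubs + <-]|b ubb].
  by rewrite leEprod => /andP[].
have : (s <= ((b, s.2) : T1 *p T2))%O.
  apply: lubs => p Dp; rewrite leEprod /= ubb /=; last by exists p.
  by move: (ubs _ Dp); rewrite leEprod => /andP[].
by rewrite leEprod => /andP[].
Qed.

Lemma supremums_snd : supremums D s -> supremums [set p.2 | p in D] s.2.
Proof.
move=> [ubs lubs]; split=> [_ [p /ubs + <-]|b ubb].
  by rewrite leEprod => /andP[].
have : (s <= ((s.1, b) : T1 *p T2))%O.
  apply: lubs => p Dp; rewrite leEprod /= ubb ?andbT; last by exists p.
  by move: (ubs _ Dp); rewrite leEprod => /andP[].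
by rewrite leEprod => /andP[].
Qed.

End ProductSupremums.

Section MuInfo.
Context (R : realType) d (A : bPOrderType d) (S : deficient_muInfo R A).
Local Notation mu := (mu S).
Local Notation Info := (Info S).
Local Notation Neginfo := (Neginfo S).
Local Notation Mea := (Mea S).
Local Notation polarity := [set Info; Neginfo].

(** * Monotonicity and modularity of [mu] *)

Lemma Mea_polarity P x : polarity P -> Mea (P x).
Proof. by case=> ->; [exact: Mea_Info|exact: Mea_Neginfo]. Qed.

Lemma polarity_le P x y : polarity P -> (x <= y)%O -> P x `<=` P y.
Proof. by case=> -> xy; [exact/Info_le|exact: Neginfo_le]. Qed.

Lemma Mea_polarityI P Q x y : polarity P -> polarity Q -> Mea (P x `&` Q y).
Proof. by move=> hP hQ; apply: MeaI; exact: Mea_polarity. Qed.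

Lemma mu_polarityI_le P Q x x' y y' : polarity P -> polarity Q ->
  (x <= x')%O -> (y <= y')%O -> mu (P x `&` Q y) <= mu (P x' `&` Q y').
Proof.
move=> hP hQ xx yy; apply: mu_le; [exact: Mea_polarityI..|].
by apply: setISS; exact: polarity_le.
Qed.

Lemma mu_setIl_le U V : Mea U -> Mea V -> mu (U `&` V) <= mu U.
Proof. by move=> mU mV; apply: mu_le => //; exact: MeaI. Qed.

Lemma mu_disjointU U V : Mea U -> Mea V -> U `&` V = set0 ->
  mu (U `|` V) = mu U + mu V.
Proof. by move=> mU mV UV; rewrite mu_modular// UV mu_set0 add0r. Qed.

(** By modularity the left side is the sum of [mu] of the union, contained in [V], and [mu] of the
    intersection, contained in [U] and [W]. *)
Lemma mu_triangle U V W : Mea U -> Mea V -> Mea W ->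
  mu (U `&` V) + mu (V `&` W) <= mu V + mu (U `&` W).
Proof.
move=> mU mV mW; rewrite mu_modular//; [|exact: MeaI..].
rewrite addrC lerD//; apply: mu_le => //; do ?[exact: MeaI|exact: MeaU].
- by apply: MeaU; exact: MeaI.
- by move=> i [[]|[]].
- by apply: MeaI; exact: MeaI.
- by move=> i [[? ?] []].
Qed.

(** The four intersections that occur in [lower] and [upper] are pairwise disjoint, so their
    measures add up to the measure of their union, which is at most 1. *)
Lemma lower_le_upper x y : lower S x y <= upper S x y.
Proof.
rewrite /lower /upper.
set a := Info x `&` Info y; set b := Neginfo x `&` Neginfo y.
set c := Info x `&` Neginfo y; set e := Info y `&` Neginfo x.
have dx i : Info x i -> Neginfo x i -> False.
  by move=> Ii Ni; have : set0 i by rewrite -(Info_Neginfo S x).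
have dy i : Info y i -> Neginfo y i -> False.
  by move=> Ii Ni; have : set0 i by rewrite -(Info_Neginfo S y).
have mI z := Mea_Info S z; have mN z := Mea_Neginfo S z.
have [ma mb mc me] : [/\ Mea a, Mea b, Mea c & Mea e].
  by split; exact: MeaI.
have Eab : mu (a `|` b) = mu a + mu b.
  by apply: mu_disjointU => //; rewrite -subset0 => i [[? ?] [? ?]]; exact: (dx i).
have Ece : mu (c `|` e) = mu c + mu e.
  by apply: mu_disjointU => //; rewrite -subset0 => i [[? ?] [? ?]]; exact: (dx i).
have mab : Mea (a `|` b) by exact: MeaU.
have mce : Mea (c `|` e) by exact: MeaU.
have : mu ((a `|` b) `|` (c `|` e)) = mu (a `|` b) + mu (c `|` e).
  apply: mu_disjointU => //; rewrite -subset0.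
  by move=> i [[[? ?]|[? ?]] [[? ?]|[? ?]]]; solve [exact: (dx i)|exact: (dy i)].
have /mu_itv/andP[_] : Mea ((a `|` b) `|` (c `|` e)) by exact: MeaU.
rewrite Eab Ece; lra.
Qed.

Lemma lower_ge0 x y : 0 <= lower S x y.
Proof.
have ge0 U : Mea U -> 0 <= mu U by move=> /mu_itv/andP[].
by rewrite addr_ge0// ge0//; exact: (MeaI (Mea_Info _ _) (Mea_Neginfo _ _)).
Qed.

Lemma upperC x y : upper S x y = upper S y x.
Proof. by rewrite /upper setIC (setIC (Neginfo x)). Qed.

Lemma lowerC x y : lower S x y = lower S y x.
Proof. by rewrite /lower addrC. Qed.

Lemma upper_self x y : (x <= y)%O -> upper S x x = upper S x y.
Proof.
move=> xy; rewrite /upper !setIid; congr (_ - mu _ - mu _); symmetry.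
- by apply/setIidPl; exact/Info_le.
- by apply/setIidPl; exact: Neginfo_le.
Qed.

(** The right side exceeds the left by the analogous [Neginfo] difference, which is nonnegative.
    This is how [mu_scott] becomes a statement about [upper]. *)
Lemma mu_Info_sub_le_upper x y :
  mu (Info x) - mu (Info x `&` Info y) <= upper S x y - upper S x x.
Proof.
rewrite /upper !setIid.
have := mu_setIl_le (Mea_Neginfo S x) (Mea_Neginfo S y); lra.
Qed.

Lemma upper_lt x y : ~ (x <= y)%O -> upper S x x < upper S x y.
Proof.
move=> nxy; have [e e0 he] := mu_scott S (scott_open_not_le y) nxy.
(* Without a strict increase of [upper], [mu_scott] would put [y] itself among the elements not
   below [y]. *)
rewrite ltNge; apply/negP => le_yx; apply: (he y _ (lexx y)).
have := mu_Info_sub_le_upper x y; lra.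
Qed.

Lemma upper_triangle x y z :
  upper S x z <= upper S x y + upper S y z - upper S y y.
Proof.
rewrite /upper !setIid.
have := mu_triangle (Mea_Info S x) (Mea_Info S y) (Mea_Info S z).
have := mu_triangle (Mea_Neginfo S x) (Mea_Neginfo S y) (Mea_Neginfo S z).
lra.
Qed.

Lemma upper_self_le x y : upper S x x <= upper S x y.
Proof.
by have [/upper_self->//|/negP/upper_lt/ltW] := boolP (x <= y)%O.
Qed.

Lemma upper_ge0 x y : 0 <= upper S x y.
Proof. exact: le_trans (lower_ge0 x y) (lower_le_upper x y). Qed.

Lemma upper_eq_le x y : upper S x x = upper S x y -> (x <= y)%O.
Proof.
by move=> e; apply: contrapT => /upper_lt; rewrite e ltxx.
Qed.

Lemma partial_metric_upper : partial_metric (upper S).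
Proof.
split; [exact: upper_ge0| |exact: upper_self_le|exact: upperC
       |exact: upper_triangle|exact: upper_self|exact: upper_lt].
move=> x y; split=> [->//|[exy eyx]].
by apply/le_anti/andP; split; apply: upper_eq_le; rewrite // upperC.
Qed.

Lemma upper_le x x' y y' : (x <= x')%O -> (y <= y')%O ->
  upper S x' y' <= upper S x y.
Proof. by move=> xx yy; rewrite /upper !lerB ?mu_polarityI_le//; by [left|right]. Qed.

Lemma lower_le x x' y y' : (x <= x')%O -> (y <= y')%O ->
  lower S x y <= lower S x' y'.
Proof.
by move=> xx yy; rewrite /lower lerD ?mu_polarityI_le//; by [left|right].
Qed.

(** * Approximation along directed sets *)

Lemma mu_directed_approx P Q (B : set A) b y (e : R) :
  polarity P -> polarity Q -> directed B -> supremums B b -> 0 < e ->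
  exists2 x, B x & mu (P b `&` Q y) - e < mu (P x `&` Q y).
Proof.
move=> hP hQ dB sB e0; rewrite (mu_directed y dB sB hP hQ).
have [|_ [x Bx <-] hx] := @sup_adherent _ [set mu (P x `&` Q y) | x in B] _ e0.
  (* [sup] is a genuine supremum here: directedness makes the set nonempty, and 1 bounds it. *)
  split; first by case: dB => -[x Bx] _; exists (mu (P x `&` Q y)), x.
  by exists 1 => _ [x _ <-]; have /mu_itv/andP[] := Mea_polarityI x y hP hQ.
by exists x.
Qed.

(** Half of [e] is spent moving the first coordinate to [p.1] against the fixed [s.2], the other
    half moving the second to [q.2] against [p.1]. Directedness then gives one pair above both [p]
    and [q]. *)
Lemma mu_directed_approx2 P Q (D : set (A *p A)%type) s (e : R) :
  polarity P -> polarity Q -> directed D -> supremums D s -> 0 < e ->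
  exists2 p, D p & mu (P s.1 `&` Q s.2) - e < mu (P p.1 `&` Q p.2).
Proof.
move=> hP hQ dD sD e0; have e20 : 0 < e / 2 by rewrite divr_gt0.
have [_ [p Dp <-] hp] := mu_directed_approx s.2 hP hQ
  (directed_fst dD) (supremums_fst sD) e20.
have [_ [q Dq <-]] := mu_directed_approx p.1 hQ hP
  (directed_snd dD) (supremums_snd sD) e20.
rewrite (setIC (Q s.2)) (setIC (Q q.2)) => hq.
have [r [Dr]] := dD.2 _ _ Dp Dq; rewrite !leEprod => /andP[pr _] /andP[_ qr].
exists r => //; have := mu_polarityI_le hP hQ pr qr; lra.
Qed.

Lemma lower_directed_approx (D : set (A *p A)%type) s (e : R) :
  directed D -> supremums D s -> 0 < e ->
  exists2 p, D p & lower S s.1 s.2 < lower S p.1 p.2 + e.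
Proof.
move=> dD sD e0; have e20 : 0 < e / 2 by rewrite divr_gt0.
have hI : polarity Info by left.
have hN : polarity Neginfo by right.
have [p Dp hp] := mu_directed_approx2 hI hN dD sD e20.
have [q Dq hq] := mu_directed_approx2 hN hI dD sD e20.
have [r [Dr]] := dD.2 _ _ Dp Dq.
rewrite !leEprod => /andP[pr1 pr2] /andP[qr1 qr2].
exists r => //; rewrite /lower !(setIC (Info _.2)).
have := mu_polarityI_le hI hN pr1 pr2; have := mu_polarityI_le hN hI qr1 qr2.
lra.
Qed.

Lemma upper_directed_approx (D : set (A *p A)%type) s (e : R) :
  directed D -> supremums D s -> 0 < e ->
  exists2 p, D p & upper S p.1 p.2 < upper S s.1 s.2 + e.
Proof.
move=> dD sD e0; have e20 : 0 < e / 2 by rewrite divr_gt0.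
have hI : polarity Info by left.
have hN : polarity Neginfo by right.
have [p Dp hp] := mu_directed_approx2 hI hI dD sD e20.
have [q Dq hq] := mu_directed_approx2 hN hN dD sD e20.
have [r [Dr]] := dD.2 _ _ Dp Dq.
rewrite !leEprod => /andP[pr1 pr2] /andP[qr1 qr2].
exists r => //; rewrite /upper.
have := mu_polarityI_le hI hI pr1 pr2; have := mu_polarityI_le hN hN qr1 qr2.
lra.
Qed.

(** * The induced relaxed metric and its Scott continuity *)

Lemma induced_itv_subproof x y :
  (0 <= (lower S x y)%:E)%E && ((lower S x y)%:E <= (upper S x y)%:E)%E.
Proof. by rewrite !lee_fin lower_ge0 lower_le_upper. Qed.

Definition induced_metric (p : (A *p A)%type) : interval_domain R :=
  @IntervalDomain R ((lower S p.1 p.2)%:E, (upper S p.1 p.2)%:E)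
    (induced_itv_subproof p.1 p.2).

Lemma relaxed_metric_induced : relaxed_metric induced_metric.
Proof.
split=> [x y|x y z].
  by apply/val_inj; rewrite /= lowerC upperC.
rewrite /rend /= lee_fin.
have := upper_triangle x y z; have := upper_ge0 y y; lra.
Qed.

Lemma scott_continuous_induced : scott_continuous induced_metric.
Proof.
have homo : {homo induced_metric : p q / (p <= q)%O}.
  move=> p q; rewrite leEprod => /andP[pq1 pq2].
  apply/andP; split; rewrite /lend /rend /= lee_fin.
  - exact: lower_le.
  - exact: upper_le.
split=> // D s dD sD; split=> [_ [p Dp <-]|c ubc].
  by apply: homo; exact: sD.1.
(* Each end at [s] is compared with that of the bound [c] up to an arbitrary [e], through a pair of
   [D] whose interval has that end within [e]. *)
apply/andP; split; apply/lee_addgt0Pr => e e0.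
- have [p Dp hp] := lower_directed_approx dD sD e0.
  have /andP[+ _] : refines (induced_metric p) c by apply: ubc; exists p.
  move=> /leeD2r - /(_ e%:E); apply: le_trans.
  by rewrite /lend /= -EFinD lee_fin ltW.
- have [p Dp hp] := upper_directed_approx dD sD e0.
  have /andP[_ +] : refines (induced_metric p) c by apply: ubc; exists p.
  move=> /le_trans; apply.
  by rewrite /rend /= -EFinD lee_fin ltW.
Qed.

(** * The relaxed metric topology and the Scott topology *)

Lemma upper_directed_approxr (B : set A) b y (e : R) :
  directed B -> supremums B b -> 0 < e ->
  exists2 x, B x & upper S y x < upper S y b + e.
Proof.
move=> dB sB e0; have e20 : 0 < e / 2 by rewrite divr_gt0.
have hI : polarity Info by left.
have hN : polarity Neginfo by right.
have [p Bp hp] := mu_directed_approx y hI hI dB sB e20.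
have [q Bq hq] := mu_directed_approx y hN hN dB sB e20.
have [r [Br pr qr]] := dB.2 _ _ Bp Bq.
exists r => //; rewrite !(upperC y) /upper.
have := mu_polarityI_le hI hI pr (lexx y).
have := mu_polarityI_le hN hN qr (lexx y).
lra.
Qed.

Lemma relaxed_open_induced : relaxed_open induced_metric = @scott_open d A.
Proof.
apply/funext => U; apply/propext; split=> [oU|oU x Ux].
  split=> [x y Ux xy|B b dB sB Ub].
    (* Since [upper S x y] equals [upper S x x] for [y] above [x], such a [y] lies in every
       admissible ball around [x]. *)
    by have [e ? /(_ y)] := oU _ Ux; apply; rewrite /= /rend /= -upper_self.
  (* The gap [e - upper S b b] is positive and serves as the tolerance for approximating [b] from
     [B]. *)
  have [e + sub] := oU _ Ub; rewrite /rend /= lte_fin -subr_gt0 => e0.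
  have [x Bx hx] := upper_directed_approxr b dB sB e0.
  exists x; split=> //; apply: sub; rewrite /= /rend /= lte_fin; lra.
have [e e0 he] := mu_scott S oU Ux.
(* The radius is shifted by [upper S x x], because [mu_scott] controls the excess over the
   self-distance. *)
exists (upper S x x + e); rewrite /= /rend /= ?lte_fin ?ltrDl//.
move=> y /=; rewrite lte_fin => hy; apply: he.
have := mu_Info_sub_le_upper x y; lra.
Qed.

End MuInfo.

Theorem theorem11p1p1 (R : realType) (d : Order.disp_t) (A : bPOrderType d)
    (hA : dcpo A) (S : deficient_muInfo R A) :
  partial_metric (upper S) /\
  exists rho : (A *p A)%type -> interval_domain R,
    [/\ forall x y : A, lend (rho (x, y)) = (lower S x y)%:E /\
                        rend (rho (x, y)) = (upper S x y)%:E,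
        relaxed_metric rho,
        scott_continuous rho &
        relaxed_open rho = @scott_open d A].
Proof.
split; first exact: partial_metric_upper.
exists (induced_metric S); split.
- by [].
- exact: relaxed_metric_induced.
- exact: scott_continuous_induced.
- exact: relaxed_open_induced.
Qed.
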